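(* Let $(a,b)$ be a bounded open interval with $0\in[a,b]$, let $q\in L^1(a,b)$ and $L=\frac{d^2}{dx^2}-q$. Let $\{\varphi_k\}$ and $\{\psi_k\}$ be standard $L$-bases such that $W(\psi_0,\psi_1)\ne0$, and let $T_\varphi,T_\psi$ be the corresponding standard transmutation operators on $\mathcal{P}(\mathbb{R})$, i.e. $T_\varphi[x^k]=\varphi_k$ and $T_\psi[x^k]=\psi_k$ for all $k\in\mathbb{N}_0$. Then $$T_\varphi=\frac{W(\varphi_0,\psi_1)}{W(\psi_0,\psi_1)}T_\psi P_+-\frac{W(\varphi_0,\psi_0)}{W(\psi_0,\psi_1)}T_\psi AP_++\frac{W(\varphi_1,\psi_1)}{W(\psi_0,\psi_1)}T_\psi\frac{d}{dx}P_--\frac{W(\varphi_1,\psi_0)}{W(\psi_0,\psi_1)}T_\psi P_-$$ on $\mathcal{P}(\mathbb{R})$.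
   Context: All functions are complex valued; $\mathbb{N}_0=\{0,1,2,\dots\}$; $\mathcal{P}(\mathbb{R})$ is the linear space of polynomials. Elements of $W^{2,1}(a,b)$ are identified with their $C^1[a,b]$ representatives. $P_\pm u(x)=\frac{u(x)\pm u(-x)}{2}$ and $Au(x)=\int_0^x u(s)\,ds$ act on $\mathcal{P}(\mathbb{R})$. $W(u,v)=uv'-u'v$ is the Wronskian; for two weak solutions of $u''=qu$ it is constant. A linear map $T$ defined on $\mathcal{P}(\mathbb{R})$ is a transmutation operator on $\mathcal{P}(\mathbb{R})$ corresponding to $L$ if for every polynomial $u$ we have $Tu\in W^{2,1}(a,b)$ and $\left(\frac{d^2}{dx^2}-q\right)Tu=Tu''$. An $L$-base is a system $\{\varphi_k\}_{k\in\mathbb{N}_0}$ with $\varphi_k''-q\varphi_k=0$ for $k=0,1$ and $\varphi_k''-q\varphi_k=k(k-1)\varphi_{k-2}$ for $k\ge2$, in the sense of weak solutions (equivalently $\varphi_k\in W^{2,1}(a,b)$ and the equations hold a.e. on $(a,b)$). A standard $L$-base is an $L$-base with $\varphi_k(0)=\varphi_k'(0)=0$ for all $k\ge2$. A transmutation operator $T$ on $\mathcal{P}(\mathbb{R})$ is standard if $\{T[x^k]\}_{k\in\mathbb{N}_0}$ is a standard $L$-base; for each standard $L$-base $\{\varphi_k\}$ the linear map on $\mathcal{P}(\mathbb{R})$ with $x^k\mapsto\varphi_k$ is a standard transmutation operator. *)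

(* Defs.v *)
From HB Require Import structures.
From mathcomp Require Import all_boot all_order all_algebra.
From mathcomp Require Import complex.
From mathcomp Require Import all_classical all_reals all_analysis.

Set Implicit Arguments.
Unset Strict Implicit.
Unset Printing Implicit Defensive.

Import Order.TTheory GRing.Theory Num.Theory.
Import numFieldNormedType.Exports.

Local Open Scope classical_set_scope.
Local Open Scope ring_scope.
Local Open Scope complex_scope.

(* Integration and differentiation of complex-valued functions of a real
   variable are performed on real and imaginary parts. *)

Definition cintegrable {R : realType} (D : set R) (f : R -> R[i]) : Prop :=
  (@lebesgue_measure R).-integrable D (fun x => (complex.Re (f x))%:E) /\
  (@lebesgue_measure R).-integrable D (fun x => (complex.Im (f x))%:E).

Definition cintegral {R : realType} (D : set R) (f : R -> R[i]) : R[i] :=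
  (\int[@lebesgue_measure R]_(x in D) complex.Re (f x)) +i*
  (\int[@lebesgue_measure R]_(x in D) complex.Im (f x)).

(* The integral of f from 0 to x, for x of any sign. *)
Definition cintegral_from0 {R : realType} (f : R -> R[i]) (x : R) : R[i] :=
  if 0 <= x then cintegral `[0, x] f else - cintegral `[x, 0] f.

(* The limit is taken inside [a, b], hence is one-sided at a and at b;
   the values of f outside [a, b] are irrelevant. *)
Definition diff_quotient {R : realType} (f : R -> R) (x y : R) : R :=
  (f y - f x) / (y - x).

Definition derive_on {R : realType} (a b : R) (f : R -> R) (x : R) : R :=
  lim (diff_quotient f x y @[y --> within `[a, b] x^']).

Definition C1_on {R : realType} (a b : R) (f : R -> R) : Prop :=
  (forall x, x \in `[a, b] ->
     cvg (diff_quotient f x y @[y --> within `[a, b] x^'])) /\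
  {within `[a, b], continuous (derive_on a b f)}.

Definition cderive_on {R : realType} (a b : R) (u : R -> R[i]) (x : R) : R[i] :=
  derive_on a b (fun y => complex.Re (u y)) x +i* derive_on a b (fun y => complex.Im (u y)) x.

Definition cC1_on {R : realType} (a b : R) (u : R -> R[i]) : Prop :=
  C1_on a b (fun y => complex.Re (u y)) /\ C1_on a b (fun y => complex.Im (u y)).

(* Real-valued C^1 functions with compact support in (a, b): a closed support
   contained in the bounded interval (a, b) is compact.  As usual for first
   order Sobolev spaces on an interval, testing against C^1 functions is enough. *)
Definition test_function {R : realType} (a b : R) (eta : R -> R) : Prop :=
  [/\ forall x, derivable eta x 1, continuous eta^`()%classic
    & closure [set x | eta x != 0] `<=` `]a, b[].

Definition weak_derivative {R : realType} (a b : R) (u v : R -> R[i]) : Prop :=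
  [/\ cintegrable `]a, b[ u, cintegrable `]a, b[ v
    & forall eta, test_function a b eta ->
        cintegral `]a, b[ (fun x => u x * (eta^`()%classic x)%:C) =
        - cintegral `]a, b[ (fun x => v x * (eta x)%:C)].

(* u is the C^1[a, b] representative of an element of W^{2,1}(a, b) whose
   second weak derivative is (the class of) v. *)
Definition sobolev21 {R : realType} (a b : R) (u v : R -> R[i]) : Prop :=
  cC1_on a b u /\
  exists w, weak_derivative a b u w /\ weak_derivative a b w v.

(* u belongs to W^{2,1}(a, b) and u'' - q u = f almost everywhere on (a, b). *)
Definition L_equation {R : realType} (a b : R) (q u f : R -> R[i]) : Prop :=
  exists v, sobolev21 a b u v /\
    {ae @lebesgue_measure R, forall x, x \in `]a, b[ ->
       v x - q x * u x = f x}.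

Definition L_base {R : realType} (a b : R) (q : R -> R[i])
    (phi : nat -> R -> R[i]) : Prop :=
  [/\ L_equation a b q (phi 0%N) (fun=> 0),
      L_equation a b q (phi 1%N) (fun=> 0)
    & forall k, (2 <= k)%N ->
        L_equation a b q (phi k)
          (fun x => (k * (k - 1))%N%:R * phi (k - 2)%N x)].

Definition standard_L_base {R : realType} (a b : R) (q : R -> R[i])
    (phi : nat -> R -> R[i]) : Prop :=
  L_base a b q phi /\
  forall k, (2 <= k)%N -> phi k 0 = 0 /\ cderive_on a b (phi k) 0 = 0.

(* Operators take their values in functions on [a, b]; values outside [a, b]
   are unconstrained.  A polynomial function of the real variable x is
   represented by the unique p : {poly R[i]} with u(x) = p.[x%:C]. *)
Definition transmutation {R : realType} (a b : R) (q : R -> R[i])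
    (T : {poly R[i]} -> R -> R[i]) : Prop :=
  (forall (c : R[i]) (p r : {poly R[i]}) x, x \in `[a, b] ->
     T (c *: p + r) x = c * T p x + T r x) /\
  (forall p, L_equation a b q (T p) (T p^`(2))).

Definition standard_transmutation {R : realType} (a b : R) (q : R -> R[i])
    (T : {poly R[i]} -> R -> R[i]) : Prop :=
  transmutation a b q T /\ standard_L_base a b q (fun k => T 'X^k).

(* A function of x; it is constant on [a, b] when u and v solve u'' = q u. *)
Definition wronskian {R : realType} (a b : R) (u v : R -> R[i]) (x : R) : R[i] :=
  u x * cderive_on a b v x - cderive_on a b u x * v x.

Definition poly_even_part {R : realType} (p : {poly R[i]}) : {poly R[i]} :=
  2^-1 *: (p + (p \Po - 'X)).

Definition poly_odd_part {R : realType} (p : {poly R[i]}) : {poly R[i]} :=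
  2^-1 *: (p - (p \Po - 'X)).

(* See horner_poly_primitive for the integral from 0 to x. *)
Definition poly_primitive {R : realType} (p : {poly R[i]}) : {poly R[i]} :=
  \poly_(i < (size p).+1) (p`_i.-1 / i%:R *+ (i != 0%N)).

Lemma horner_poly_even_part {R : realType} (p : {poly R[i]}) (x : R) :
  (poly_even_part p).[x%:C] = (p.[x%:C] + p.[(- x)%:C]) / 2.
Proof. by rewrite !hornerE horner_comp !hornerE rmorphN mulrC. Qed.

Lemma horner_poly_odd_part {R : realType} (p : {poly R[i]}) (x : R) :
  (poly_odd_part p).[x%:C] = (p.[x%:C] - p.[(- x)%:C]) / 2.
Proof. by rewrite !hornerE horner_comp !hornerE rmorphN mulrC. Qed.

Lemma deriv_poly_primitive {R : realType} (p : {poly R[i]}) :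
  (poly_primitive p)^`() = p.
Proof.
apply/polyP => i; rewrite coef_deriv coef_poly /= ltnS mulr1n.
case: ltnP => [_|pi]; first by rewrite -mulrnAl -mulr_natr mulfK // pnatr_eq0.
by rewrite mul0rn nth_default.
Qed.

Lemma horner0_poly_primitive {R : realType} (p : {poly R[i]}) :
  (poly_primitive p).[0] = 0.
Proof. by rewrite horner_coef0 coef_poly. Qed.

Lemma horner_Re_Im {R : realType} (p : {poly R[i]}) (x : R) :
  p.[x%:C] = (map_poly (@complex.Re R) p).[x] +i* (map_poly (@complex.Im R) p).[x].
Proof.
rewrite horner_coef !horner_poly.
rewrite (eq_bigr (fun i : 'I_(size p) =>
  (complex.Re p`_i * x ^+ i) +i* (complex.Im p`_i * x ^+ i))); last first.
  move=> i _; rewrite -rmorphXn /=; case: (p`_i) => u v.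
  by rewrite /GRing.mul /= !mulr0 subr0 add0r.
by elim/big_rec3: _ => //= i x1 x2 x3 _ ->.
Qed.

Lemma deriv_map_Re {R : realType} (p : {poly R[i]}) :
  (map_poly (@complex.Re R) p)^`() = map_poly (@complex.Re R) p^`().
Proof.
by apply/polyP => i; rewrite coef_deriv !coef_map_id0// coef_deriv raddfMn.
Qed.

Lemma deriv_map_Im {R : realType} (p : {poly R[i]}) :
  (map_poly (@complex.Im R) p)^`() = map_poly (@complex.Im R) p^`().
Proof.
by apply/polyP => i; rewrite coef_deriv !coef_map_id0// coef_deriv raddfMn.
Qed.

Lemma Rintegral_deriv_poly {R : realType} (p : {poly R}) (x y : R) : x <= y ->
  (\int[@lebesgue_measure R]_(t in `[x, y]) (p^`()).[t]) = p.[y] - p.[x].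
Proof.
rewrite le_eqVlt => /predU1P[->|xy].
  by rewrite set_itv1 Rintegral_set1 subrr.
rewrite /Rintegral (@continuous_FTC2 R (horner p^`()) (horner p))//.
- by apply: continuous_subspaceT => t; exact: continuous_horner.
- split.
  + by move=> t _; exact: derivable_horner.
  + by apply: cvg_at_right_filter; exact: continuous_horner.
  + by apply: cvg_at_left_filter; exact: continuous_horner.
- by move=> t _; rewrite -derivE.
Qed.

Lemma cintegral_deriv_poly {R : realType} (p : {poly R[i]}) (x y : R) : x <= y ->
  cintegral `[x, y] (fun t => (p^`()).[t%:C]) = p.[y%:C] - p.[x%:C].
Proof.
move=> xy; rewrite /cintegral !horner_Re_Im.
under eq_Rintegral do rewrite horner_Re_Im /= -deriv_map_Re.
under [X in _ +i* X]eq_Rintegral do rewrite horner_Re_Im /= -deriv_map_Im.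
by rewrite !Rintegral_deriv_poly.
Qed.

Lemma horner_poly_primitive {R : realType} (p : {poly R[i]}) (x : R) :
  (poly_primitive p).[x%:C] = cintegral_from0 (fun t => p.[t%:C]) x.
Proof.
rewrite /cintegral_from0 -{2 3}(deriv_poly_primitive p).
case: leP => [x0|/ltW x0]; rewrite cintegral_deriv_poly// horner0_poly_primitive.
  by rewrite subr0.
by rewrite sub0r opprK.
Qed.

(* Main.v *)
Require Import Defs.
From HB Require Import structures.
From mathcomp Require Import all_boot all_order all_algebra.
From mathcomp Require Import complex.
From mathcomp Require Import all_classical all_reals all_analysis.
From mathcomp Require Import ring lra.

Set Implicit Arguments.
Unset Strict Implicit.
Unset Printing Implicit Defensive.

Import Order.TTheory GRing.Theory Num.Theory.
Import numFieldNormedType.Exports.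

Local Open Scope classical_set_scope.
Local Open Scope ring_scope.
Local Open Scope complex_scope.

(** Two facts carry the proof.

    The first is uniqueness for the Cauchy problem (L_equation_unique0): a
    W^{2,1} function u with u'' = q u almost everywhere and u(s) = u'(s) = 0 at
    some s of [a, b], endpoints included, vanishes on [a, b].  The weak second
    derivative v = q u is only known through integration against test functions,
    so the key estimate is
      |u'(x) - u'(y)| <= int_c^d |v|   for x, y in [c, d]
    (C1_weak_le).  It comes from testing against a plateau, close to the
    indicator of [x, y], whose derivative is an approximate unit mass at x minus
    one at y.  A contraction argument on short intervals then gives u = 0 step by
    step along [a, b].

    The second is that the coefficients of the formula are those of phi_0 and
    phi_1 in the basis (psi_0, psi_1) of the solutions of u'' = q u: by Cramer's
    rule, with Wronskians as determinants,
      phi_0 = c00 psi_0 + c01 psi_1,   phi_1 = c10 psi_0 + c11 psi_1,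
    where c00 = W(phi_0, psi_1)/W, c01 = - W(phi_0, psi_0)/W and so on,
    W = W(psi_0, psi_1).  Induction on j, again by uniqueness, now with
    vanishing Cauchy data at 0, gives (standard_L_base_comb)
      phi_{2j}   = c00 psi_{2j} + c01/(2j+1) psi_{2j+1},
      phi_{2j+1} = (2j+1) c10 psi_{2j} + c11 psi_{2j+1}.
    Since A x^{2j} = x^{2j+1}/(2j+1) and (x^{2j+1})' = (2j+1) x^{2j}, this is
    the asserted identity on monomials, and both sides are linear. *)

(** * Splines with a continuous second derivative *)

Section TruncatedPower.
Context {R : realType}.
Implicit Types (c h t x : R) (n : nat).

Definition tpow n c t : R := Num.max 0 (t - c) ^+ n.

Lemma tpow_le n c t : t <= c -> tpow n.+1 c t = 0.
Proof. by move=> tc; rewrite /tpow max_l ?subr_le0// expr0n. Qed.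

Lemma tpow_ge n c t : c <= t -> tpow n c t = (t - c) ^+ n.
Proof. by move=> ct; rewrite /tpow max_r ?subr_ge0. Qed.

Lemma continuous_tpow n c : continuous (tpow n c).
Proof.
move=> t; apply: (@continuous_comp _ _ _ (fun u : R => Num.max 0 (u - c))
  (fun u : R => u ^+ n)); last first.
  exact: exprn_continuous.
apply: (@continuous_max _ _ (cst 0) (fun u : R => u - c)); first exact: cvg_cst.
by apply: cvgB; [exact: cvg_id|exact: cvg_cst].
Qed.

(** The exponent at least 2 makes the two one-sided derivatives at the knot c
    agree. *)
Lemma is_derive_tpow n c t :
  is_derive t 1 (tpow n.+2 c) (n.+2%:R * tpow n.+1 c t).
Proof.
have dB : is_derive t 1 (fun u : R => (u - c) ^+ n.+2) (n.+2%:R * (t - c) ^+ n.+1).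
  have dl : is_derive t 1 (fun u : R => u - c) 1.
    by have := is_deriveB (is_derive_id t 1) (is_derive_cst c t 1); rewrite subr0.
  have := is_deriveX n.+2 dl.
  rewrite [X in is_derive _ _ X](_ : _ = fun u : R => (u - c) ^+ n.+2); last first.
    by apply/funext => u; rewrite fctE.
  by rewrite /GRing.scale/= mulr1 mulr_natl.
have [tc|ct|tc] := ltgtP t c.
- rewrite tpow_le ?(ltW tc)// mulr0.
  have := @is_derive_cst R R R 0 t 1.
  apply: near_eq_is_derive => //.
  near=> u; rewrite tpow_le//; near: u.
  by apply: filterS (lt_nbhsl tc) => u /ltW.
- rewrite tpow_ge ?(ltW ct)//; move: dB.
  apply: near_eq_is_derive => //.
  near=> u; rewrite tpow_ge//; near: u.
  by apply: filterS (lt_nbhsr ct) => u /ltW.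
- rewrite tc tpow_le// mulr0.
  have cv : (fun h => h^-1 *: (tpow n.+2 c (h *: 1 + c) - tpow n.+2 c c)) @ 0^' --> (0:R).
    have : tpow n.+1 0 h @[h --> 0^'] --> (0 : R).
      rewrite -[X in _ --> X](@tpow_le n 0 0)//.
      apply: cvg_trans (@continuous_tpow n.+1 0 0).
      exact: cvg_app (@nbhs_dnbhs _ _).
    apply: cvg_trans; apply: near_eq_cvg; near=> h.
    rewrite [tpow _ c c]tpow_le// subr0 /tpow /GRing.scale/= mulr1 addrK subr0.
    have [h0|h0] := leP h 0.
      by rewrite !expr0n/= mulr0.
    by rewrite [in RHS]exprS mulKf// gt_eqF.
  apply: DeriveDef; first by apply/cvg_ex; exists 0.
  exact: cvg_lim.
Unshelve. all: by end_near. Qed.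

(** Unnormalized B-spline with knots c, c + h, c + 2h, c + 3h: the third
    difference of truncated powers.  In degree 2 it is a bump supported on
    [c, c + 3h]; in degree 3 it is, up to a constant factor, the primitive of that
    bump, hence a smooth step from 0 to 6 h^3. *)
Definition bspline n c h t : R :=
  tpow n c t - 3 * tpow n (c + h) t + 3 * tpow n (c + 2 * h) t - tpow n (c + 3 * h) t.

Lemma continuous_bspline n c h : continuous (bspline n c h).
Proof.
move=> t; apply: cvgB; last exact: continuous_tpow.
apply: cvgD; last by apply: cvgM; [exact: cvg_cst|exact: continuous_tpow].
apply: cvgB; first exact: continuous_tpow.
by apply: cvgM; [exact: cvg_cst|exact: continuous_tpow].
Qed.

Lemma is_derive_bspline n c h t :
  is_derive t 1 (bspline n.+2 c h) (n.+2%:R * bspline n.+1 c h t).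
Proof.
have d3 d := is_deriveZ 3 (is_derive_tpow n d t).
have := is_deriveB (is_deriveD (is_deriveB (is_derive_tpow n c t) (d3 (c + h)))
  (d3 (c + 2 * h))) (is_derive_tpow n (c + 3 * h) t).
rewrite [X in is_derive _ _ X](_ : _ = bspline n.+2 c h); last first.
  by apply/funext.
by move/is_derive_eq; apply; rewrite /bspline /GRing.scale/=; ring.
Qed.

Lemma bspline_left n c h t : 0 <= h -> t <= c -> bspline n.+1 c h t = 0.
Proof.
by move=> h0 tc; rewrite /bspline !tpow_le; [ring|lra..].
Qed.

(** To the right of all knots the spline is the third difference of a polynomial
    of degree 2, hence zero; in degree 3 it is a constant. *)
Lemma bspline2_right c h t : 0 <= h -> c + 3 * h <= t -> bspline 2 c h t = 0.
Proof. by move=> h0 tc; rewrite /bspline !tpow_ge; [ring|lra..]. Qed.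

Lemma bspline3_right c h t : 0 <= h -> c + 3 * h <= t -> bspline 3 c h t = 6 * h ^+ 3.
Proof. by move=> h0 tc; rewrite /bspline !tpow_ge; [ring|lra..]. Qed.

Lemma bspline2_ge0 c h t : 0 <= h -> 0 <= bspline 2 c h t.
Proof.
move=> h0.
have [tc|ct] := leP t c; first by rewrite bspline_left.
have [tc'|ct'] := leP (c + 3 * h) t; first by rewrite bspline2_right.
rewrite /bspline (@tpow_ge _ c) ?(ltW ct)// (@tpow_le _ (c + 3 * h)) ?(ltW ct')//.
have [t1|t1] := leP t (c + h).
  by rewrite !tpow_le; [nra|lra..].
rewrite (@tpow_ge _ (c + h)) ?(ltW t1)//.
have [t2|t2] := leP t (c + 2 * h).
  by rewrite tpow_le//; nra.
by rewrite tpow_ge ?(ltW t2)//; nra.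
Qed.

Lemma bspline3_homo c h : 0 <= h -> {homo bspline 3 c h : x y / x <= y}.
Proof.
move=> h0 x y xy.
have [z _ e] : exists2 z, z \in `[x, y]%R &
    bspline 3 c h y - bspline 3 c h x = 3 * bspline 2 c h z * (y - x).
  apply: (@MVT_segment R (bspline 3 c h) (fun z => 3 * bspline 2 c h z)) => //.
    by move=> z _; exact: is_derive_bspline.
  by apply: continuous_subspaceT; exact: continuous_bspline.
by rewrite -subr_ge0 e mulr_ge0 ?subr_ge0// mulr_ge0// bspline2_ge0.
Qed.

Lemma bspline3_bounds c h t : 0 <= h -> 0 <= bspline 3 c h t <= 6 * h ^+ 3.
Proof.
move=> h0; apply/andP; split.
- rewrite -(@bspline_left 2 c h (Num.min c t)) ?ge_min ?lexx//.
  by apply: bspline3_homo; rewrite // ge_min lexx orbT.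
- rewrite -(@bspline3_right c h (Num.max (c + 3 * h) t)) ?le_max ?lexx//.
  by apply: bspline3_homo; rewrite // le_max lexx orbT.
Qed.

End TruncatedPower.

(** * Functions of class C^1 on a closed interval *)

Section DeriveOn.
Context {R : realType}.
Variables (a b : R).
Hypothesis ab : a < b.
Implicit Types (f g : R -> R) (x : R).

(** No point of [a, b] is isolated in it, so limits of difference quotients are
    unique, also at the endpoints. *)
Lemma within_dnbhs_proper x : x \in `[a, b] -> ProperFilter (within `[a, b] x^').
Proof.
rewrite in_itv/= => /andP[ax xb]; split; last exact: within_filter.
rewrite /within/= => /nbhs_ballP[e /= e0 H].
have [xb'|bx] := ltP x b.
- pose y := x + Num.min (e / 2) (b - x).
  have m0 : 0 < Num.min (e / 2) (b - x) by rewrite lt_min subr_gt0 xb' divr_gt0.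
  have m1 : Num.min (e / 2) (b - x) <= e / 2 by rewrite ge_min lexx.
  have m2 : Num.min (e / 2) (b - x) <= b - x by rewrite ge_min lexx orbT.
  apply: (H y); rewrite /y.
  + rewrite /ball/= opprD addrA subrr sub0r normrN gtr0_norm//; lra.
  + by apply/eqP; lra.
  + by rewrite in_itv/=; apply/andP; split; lra.
- pose y := x - Num.min (e / 2) (x - a).
  have m0 : 0 < Num.min (e / 2) (x - a).
    by rewrite lt_min subr_gt0 divr_gt0//= (lt_le_trans ab).
  have m1 : Num.min (e / 2) (x - a) <= e / 2 by rewrite ge_min lexx.
  have m2 : Num.min (e / 2) (x - a) <= x - a by rewrite ge_min lexx orbT.
  apply: (H y); rewrite /y.
  + rewrite /ball/= opprB addrCA subrr addr0 gtr0_norm//; lra.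
  + by apply/eqP; lra.
  + by rewrite in_itv/=; apply/andP; split; lra.
Qed.

Lemma C1_on_continuous f : C1_on a b f -> {within `[a, b], continuous f}.
Proof.
move=> [df _]; apply/subspace_continuousP => x xab.
pose F := within `[a, b] x^'.
have lim_prod : (diff_quotient f x y * (y - x)) @[y --> F] --> (0 : R).
  rewrite -[X in _ --> X](mulr0 (derive_on a b f x)).
  apply: cvgM; first exact: df.
  rewrite -[X in _ --> X](subrr x).
  apply: cvgB; last exact: cvg_cst.
  move=> A nA; apply: cvg_within; exact: (@nbhs_dnbhs _ x).
apply/cvgrPdist_lt => e e0.
have /cvgrPdist_lt/(_ e e0) H := lim_prod.
have {}H : \forall y \near x, y != x -> `[a, b]%classic y ->
  `|0 - diff_quotient f x y * (y - x)| < e by exact: H.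
suff : \forall y \near x, `[a, b]%classic y -> `|f x - f y| < e by [].
apply: filterS H => y H yab.
have [->|yx] := eqVneq y x; first by rewrite subrr normr0.
have := H yx yab.
by rewrite sub0r normrN /diff_quotient divfK ?subr_eq0// distrC.
Qed.

Lemma C1_on_is_derive f x : C1_on a b f -> x \in `]a, b[ ->
  is_derive x 1 f (derive_on a b f x).
Proof.
move=> [df _] xab.
have xab' : x \in `[a, b] by apply: subset_itv_oo_cc.
have cv : (fun h => h^-1 *: (f (h *: 1 + x) - f x)) @ 0^' --> derive_on a b f x.
  apply/cvgrPdist_lt => e e0.
  have /cvgrPdist_lt/(_ e e0) H := df _ xab'.
  have nab : \forall y \near x, y \in `[a, b]%R.
    by apply: filterS (near_in_itvoo xab) => y; apply: subset_itv_oo_cc.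
  have {H} H : \forall y \near x, y != x ->
      `|derive_on a b f x - diff_quotient f x y| < e.
    have {}H : \forall y \near x, y != x -> `[a, b]%classic y ->
      `|derive_on a b f x - diff_quotient f x y| < e by exact: H.
    by apply: filterS2 H nab => y + yab yx; apply.
  have : \forall h \near (0:R), h + x != x ->
      `|derive_on a b f x - diff_quotient f x (h + x)| < e.
    have : (h + x) @[h --> (0:R)] --> x.
      rewrite -[X in _ --> X]add0r; apply: cvgD; [exact: cvg_id|exact: cvg_cst].
    by move=> /(_ _ H).
  move=> {}H; suff : \forall h \near (0:R), h != 0 ->
    `|derive_on a b f x - h^-1 *: (f (h *: 1 + x) - f x)| < e by [].
  apply: filterS H => h + h0.
  rewrite -subr_eq0 addrK h0 => /(_ isT).
  by rewrite /diff_quotient addrK /GRing.scale/= mulr1 mulrC.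
apply: DeriveDef; first by apply/cvg_ex; exists (derive_on a b f x).
exact: cvg_lim cv.
Qed.

Lemma C1_on_MVT f x y : C1_on a b f -> a <= x -> x <= y -> y <= b ->
  exists2 z, z \in `[x, y] & f y - f x = derive_on a b f z * (y - x).
Proof.
move=> cf ax xy yb; apply: MVT_segment => //.
  move=> z zxy; apply: C1_on_is_derive => //.
  move: zxy; rewrite !in_itv/= => /andP[xz zy]; apply/andP; split; lra.
apply: continuous_subspaceW (C1_on_continuous cf).
by apply: subset_itv; rewrite bnd_simp.
Qed.

Lemma diff_quotient_lin (r : R) f g x y :
  diff_quotient (fun z => r * f z + g z) x y =
  r * diff_quotient f x y + diff_quotient g x y.
Proof. by rewrite /diff_quotient; ring. Qed.

Lemma cvg_diff_quotient_lin (r : R) f g x :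
  C1_on a b f -> C1_on a b g -> x \in `[a, b] ->
  diff_quotient (fun z => r * f z + g z) x y @[y --> within `[a, b] x^'] -->
  r * derive_on a b f x + derive_on a b g x.
Proof.
move=> [df _] [dg _] xab.
under eq_fun do rewrite diff_quotient_lin.
by apply: cvgD; [apply: cvgM; [exact: cvg_cst|exact: df]|exact: dg].
Qed.

Lemma derive_on_lin (r : R) f g x :
  C1_on a b f -> C1_on a b g -> x \in `[a, b] ->
  derive_on a b (fun z => r * f z + g z) x =
  r * derive_on a b f x + derive_on a b g x.
Proof.
move=> cf cg xab; have pf := within_dnbhs_proper xab.
by apply: cvg_lim => //; exact: cvg_diff_quotient_lin.
Qed.

Lemma C1_on_lin (r : R) f g :
  C1_on a b f -> C1_on a b g -> C1_on a b (fun z => r * f z + g z).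
Proof.
move=> cf cg; split=> [x xab|].
  by apply/cvg_ex; eexists; exact: cvg_diff_quotient_lin.
apply: (@subspace_eq_continuous _ _ _
  (fun x => r * derive_on a b f x + derive_on a b g x)).
  by move=> x; rewrite inE => xab; rewrite /from_subspace derive_on_lin.
move=> x; apply: cvgD; last exact: cg.2.
by apply: cvgM; [exact: cvg_cst|exact: cf.2].
Qed.

End DeriveOn.

(** * Oscillation of the derivative of a function with a weak second derivative *)

Section MeanInequality.
Context {R : realType}.
Notation mu := (@lebesgue_measure R).
Variables (a b : R).
Hypothesis ab : a < b.
Implicit Types (f g v : R -> R) (x y h : R).

Lemma continuous_itv_integrable g : {within `[a, b], continuous g} ->
  mu.-integrable `[a, b] (EFin \o g).
Proof. by move=> cg; apply: continuous_compact_integrable => //; exact: segment_compact. Qed.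

Lemma within_continuousM f g : {within `[a, b], continuous f} ->
  {within `[a, b], continuous g} -> {within `[a, b], continuous (fun t => f t * g t)}.
Proof. by move=> cf cg t; apply: cvgM; [exact: cf|exact: cg]. Qed.

Lemma Rintegral_bspline2 x h : 0 <= h -> a <= x -> x + 3 * h <= b ->
  \int[mu]_(t in `[a, b]) (3 * bspline 2 x h t) = 6 * h ^+ 3.
Proof.
move=> h0 ax xb.
rewrite /Rintegral (@continuous_FTC2 R (fun t => 3 * bspline 2 x h t) (bspline 3 x h))//.
- by rewrite (@bspline3_right _ _ _ b)// (@bspline_left _ _ _ _ a)//= subr0.
- apply: continuous_subspaceT => t; apply: cvgM; first exact: cvg_cst.
  exact: continuous_bspline.
- split.
  + by move=> t _; have [] := is_derive_bspline 1 x h t.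
  + by apply: cvg_at_right_filter; exact: continuous_bspline.
  + by apply: cvg_at_left_filter; exact: continuous_bspline.
- by move=> t _; rewrite derive1E; have [_ ->] := is_derive_bspline 1 x h t.
Qed.

(** Three times the quadratic spline at x is, up to the factor 6 h^3, an
    approximate unit mass at x. *)
Lemma bspline2_mean g x h e : 0 <= h -> a <= x -> x + 3 * h <= b ->
  {within `[a, b], continuous g} ->
  (forall t, x <= t -> t <= x + 3 * h -> `|g t - g x| <= e) ->
  `|\int[mu]_(t in `[a, b]) (g t * (3 * bspline 2 x h t)) - g x * (6 * h ^+ 3)| <=
  e * (6 * h ^+ 3).
Proof.
move=> h0 ax xb cg ge.
have cB : {within `[a, b], continuous (fun t => 3 * bspline 2 x h t)}.
  apply: continuous_subspaceT => t; apply: cvgM; first exact: cvg_cst.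
  exact: continuous_bspline.
have cC (r : R) : {within `[a, b], continuous (fun _ => r)}.
  by apply: continuous_subspaceT => t; exact: cvg_cst.
have cgx : {within `[a, b], continuous (fun t => g t - g x)}.
  by move=> t; apply: cvgB; [exact: cg|exact: cvg_cst].
have cD : {within `[a, b], continuous
    (fun t => g t * (3 * bspline 2 x h t) - g x * (3 * bspline 2 x h t))}.
  move=> t; apply: cvgB; first exact: (within_continuousM cg cB).
  exact: (within_continuousM (cC _) cB).
have iI := continuous_itv_integrable.
have mI : measurable (`[a, b] : set (measurableTypeR R)) by [].
rewrite -(Rintegral_bspline2 h0 ax xb) -!RintegralZl//; last 2 first.
  exact: iI.
  exact: iI.
rewrite -RintegralB//; last 2 first.
  exact/iI/within_continuousM.
  exact/iI/within_continuousM.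
apply: le_trans (le_normr_Rintegral _ _) _ => //.
  exact: iI cD.
apply: le_Rintegral => //.
- by apply: iI => t; apply: (@cvg_norm _ R^o); exact: cD.
- exact/iI/within_continuousM.
move=> t _; rewrite -mulrBl normrM [X in _ * X]ger0_norm; last first.
  by rewrite mulr_ge0// bspline2_ge0.
have [tx|xt] := leP t x; first by rewrite bspline_left// !mulr0.
have [tx|xt'] := leP (x + 3 * h) t; first by rewrite bspline2_right// !mulr0.
by rewrite ler_wpM2r ?ge// ?(ltW xt) ?(ltW xt')// mulr_ge0// bspline2_ge0.
Qed.

(** A C^2 approximation, up to the factor 6 h^3, of the indicator of [x, y]. *)
Definition plateau x y h t : R := bspline 3 x h t - bspline 3 y h t.

Lemma derive1_plateau x y h :
  (plateau x y h)^`()%classic = (fun t => 3 * (bspline 2 x h t - bspline 2 y h t)).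
Proof.
apply/funext => t; rewrite derive1E mulrBr.
by have [_ ->] := is_deriveB (is_derive_bspline 1 x h t) (is_derive_bspline 1 y h t).
Qed.

Lemma derive2_plateau x y h :
  (plateau x y h)^`()^`()%classic = (fun t => 6 * (bspline 1 x h t - bspline 1 y h t)).
Proof.
rewrite derive1_plateau; apply/funext => t; rewrite derive1E.
have [_ ->] := is_deriveZ 3
  (is_deriveB (is_derive_bspline 0 x h t) (is_derive_bspline 0 y h t)).
by rewrite /GRing.scale/=; ring.
Qed.

Lemma plateau_out x y h t : 0 <= h -> x <= y ->
  t \notin `[x, y + 3 * h] -> plateau x y h t = 0.
Proof.
move=> h0 xy; rewrite in_itv/= negb_and -!ltNge => /orP[tx|yt].
  by rewrite /plateau !bspline_left ?subr0//; lra.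
by rewrite /plateau !bspline3_right ?subrr//; lra.
Qed.

Lemma derive1_plateau_out x y h t : 0 <= h -> x <= y ->
  t \notin `[x, y + 3 * h] -> (plateau x y h)^`()%classic t = 0.
Proof.
move=> h0 xy; rewrite in_itv/= negb_and -!ltNge derive1_plateau => /orP[tx|yt].
  by rewrite !bspline_left ?subr0 ?mulr0//; lra.
by rewrite !bspline2_right ?subrr ?mulr0//; lra.
Qed.

Lemma plateau_bound x y h t : 0 <= h -> `|plateau x y h t| <= 6 * h ^+ 3.
Proof.
move=> h0; have /andP[? ?] := bspline3_bounds x t h0.
have /andP[? ?] := bspline3_bounds y t h0.
by rewrite /plateau ler_norml; apply/andP; split; lra.
Qed.

Lemma closure_support_itv (g : R -> R) x y : a < x -> y < b ->
  (forall t, t \notin `[x, y] -> g t = 0) ->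
  closure [set t | g t != 0] `<=` `]a, b[.
Proof.
move=> ax yb g0.
have xy_ab : `[x, y]%classic `<=` `]a, b[%classic by apply: subset_itv; rewrite bnd_simp.
move=> t ct; apply: xy_ab; apply: (@itv_closed _ R); move: t ct.
apply: closureS => t /= gt; apply: contraNT gt => txy.
by apply/eqP/g0.
Qed.

Lemma plateau_test x y h : 0 <= h -> a < x -> x <= y -> y + 3 * h < b ->
  test_function a b (plateau x y h) /\ test_function a b (plateau x y h)^`()%classic.
Proof.
move=> h0 ax xy yb; split; split.
- by move=> t; have [] := is_deriveB (is_derive_bspline 1 x h t) (is_derive_bspline 1 y h t).
- rewrite derive1_plateau => t; apply: cvgM; first exact: cvg_cst.
  by apply: cvgB; exact: continuous_bspline.
- apply: closure_support_itv ax yb _ => t; exact: plateau_out.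
- rewrite derive1_plateau => t.
  by have [] := is_deriveZ 3
    (is_deriveB (is_derive_bspline 0 x h t) (is_derive_bspline 0 y h t)).
- rewrite derive2_plateau => t; apply: cvgM; first exact: cvg_cst.
  by apply: cvgB; exact: continuous_bspline.
- apply: closure_support_itv ax yb _ => t; exact: derive1_plateau_out.
Qed.

(** Composing two first order weak derivatives tests against eta with eta' itself
    a test function, which is why both conditions are required of eta. *)
Definition weak_second_derivative f v :=
  forall eta, test_function a b eta -> test_function a b eta^`()%classic ->
    \int[mu]_(x in `]a, b[) (f x * eta^`()^`()%classic x) =
    \int[mu]_(x in `]a, b[) (v x * eta x).

Lemma Rintegral_oo_cc g : {within `[a, b], continuous g} ->
  \int[mu]_(t in `]a, b[) g t = \int[mu]_(t in `[a, b]) g t.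
Proof.
move=> cg; have ig := continuous_itv_integrable cg.
rewrite Rintegral_itv_bndo_bndc ?Rintegral_itv_obnd_cbnd//.
  apply: integrableS ig => //.
  by apply: subset_itv; rewrite bnd_simp.
apply: integrableS ig => //.
by apply: subset_itv; rewrite bnd_simp.
Qed.

Lemma continuous_derive1_plateau x y h : continuous (plateau x y h)^`()%classic.
Proof.
rewrite derive1_plateau => t; apply: cvgM; first exact: cvg_cst.
by apply: cvgB; exact: continuous_bspline.
Qed.

(** Integration by parts moves one of the two derivatives of the plateau back to f,
    which is classically differentiable inside (a, b). *)
Lemma derive_on_plateau f v x y h : C1_on a b f -> weak_second_derivative f v ->
  0 <= h -> a < x -> x <= y -> y + 3 * h < b ->
  \int[mu]_(t in `[a, b]) (derive_on a b f t * (plateau x y h)^`()%classic t) =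
  - \int[mu]_(t in `]a, b[) (v t * plateau x y h t).
Proof.
move=> cf fv h0 ax xy yb; have [t1 t2] := plateau_test h0 ax xy yb.
have cf0 := C1_on_continuous cf.
have c2 : continuous (plateau x y h)^`()^`()%classic.
  rewrite derive2_plateau => t; apply: cvgM; first exact: cvg_cst.
  by apply: cvgB; exact: continuous_bspline.
rewrite -fv// Rintegral_oo_cc; last first.
  by apply: within_continuousM => //; exact: continuous_subspaceT.
rewrite (@Rintegration_by_parts _ f (plateau x y h)^`()%classic (derive_on a b f))//.
- rewrite !derive1_plateau_out//; last 2 first.
  + by rewrite in_itv/= negb_and -!ltNge ax.
  + by rewrite in_itv/= negb_and -!ltNge yb orbT.
  by rewrite !mulr0 subrr sub0r opprK.
- exact: cf.2.
- split.
  + by move=> t tab; have [] := C1_on_is_derive cf tab.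
  + by have /(continuous_within_itvP _ ab)[] := cf0.
  + by have /(continuous_within_itvP _ ab)[] := cf0.
- by move=> t tab; rewrite derive1E; have [_ ->] := C1_on_is_derive cf tab.
- exact: continuous_subspaceT.
- split.
  + by move=> t _; have [+ _ _] := t2; exact.
  + by apply: cvg_at_right_filter; exact: continuous_derive1_plateau.
  + by apply: cvg_at_left_filter; exact: continuous_derive1_plateau.
Qed.

Lemma integrableM_continuous v g (D : set R) : measurable D ->
  mu.-integrable D (EFin \o v) -> continuous g ->
  (exists K, forall t, D t -> `|g t| <= K) ->
  mu.-integrable D (EFin \o (fun t => v t * g t)).
Proof.
move=> mD iv cg [K gK].
apply: (@integrableMl _ (measurableTypeR R) R mu D mD (EFin \o v) g iv).
  apply: measurable_funTS; exact: measurable_realfun.continuous_measurable_fun.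
exists K; split; first exact: num_real.
by move=> M KM t Dt; exact: le_trans (gK t Dt) (ltW KM).
Qed.

Lemma continuous_plateau x y h : continuous (plateau x y h).
Proof. by move=> t; apply: cvgB; exact: continuous_bspline. Qed.

Lemma Rintegral_plateau_le v c d x y h : 0 <= h -> a <= c -> d <= b ->
  c < x -> x <= y -> y + 3 * h < d -> mu.-integrable `]a, b[ (EFin \o v) ->
  `|\int[mu]_(t in `]a, b[) (v t * plateau x y h t)| <=
  6 * h ^+ 3 * \int[mu]_(t in `]c, d[) `|v t|.
Proof.
move=> h0 ac db cx xy yd iv.
have cdab : `]c, d[%classic `<=` `]a, b[%classic by apply: subset_itv; rewrite bnd_simp.
have iv' : mu.-integrable `]c, d[ (EFin \o v) by exact: integrableS iv.
have -> : \int[mu]_(t in `]a, b[) (v t * plateau x y h t) =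
    \int[mu]_(t in `]c, d[) (v t * plateau x y h t).
  rewrite -[in RHS](setIidr cdab) Rintegral_mkcondr; apply: eq_Rintegral => t _.
  rewrite patchE; case: ifPn => // /negP tcd.
  rewrite plateau_out ?mulr0//; apply/negP => txy; apply: tcd.
  move: txy; rewrite inE/= !in_itv/= => /andP[xt ty]; apply/andP; split; lra.
have ivp : mu.-integrable `]c, d[ (EFin \o (fun t => v t * plateau x y h t)).
  apply: integrableM_continuous => //; first exact: continuous_plateau.
  by exists (6 * h ^+ 3) => t _; exact: plateau_bound.
apply: le_trans (le_normr_Rintegral _ ivp) _ => //.
have inv' : mu.-integrable `]c, d[ (EFin \o (fun t => `|v t|)).
  exact: integrable_norm.
rewrite -RintegralZl//; apply: le_Rintegral => //.
- exact: integrable_norm ivp.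
- by have := integrableZl _ (6 * h ^+ 3) inv'; apply.
- by move=> t _; rewrite normrM mulrC ler_wpM2r// plateau_bound.
Qed.

(** With the plateau of [x, y], the left side of derive_on_plateau is within
    e * 6 h^3 of (f' x - f' y) * 6 h^3, and its right side is at most 6 h^3 times
    the integral of |v| over any interval that contains the support.  Dividing by
    6 h^3 removes the dependence on h. *)
Lemma C1_weak_le_interior f v c d x y : C1_on a b f ->
  weak_second_derivative f v -> mu.-integrable `]a, b[ (EFin \o v) ->
  a <= c -> d <= b -> c < x -> x <= y -> y < d ->
  `|derive_on a b f x - derive_on a b f y| <= \int[mu]_(t in `]c, d[) `|v t|.
Proof.
move=> cf fv iv ac db cx xy yd.
apply/ler_addgt0Pr => e e0; set I := \int[mu]_(_ in _) _.
set f' := derive_on a b f.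
have cf' : {within `[a, b], continuous f'} by exact: cf.2.
have small z : z \in `]a, b[ -> \forall h \near 0^'+,
    forall t, z <= t -> t <= z + 3 * h -> `|f' t - f' z| <= e / 2.
  move=> zab; have /cvgrPdist_le := within_continuous_continuous ab cf' zab.
  move=> /(_ (e / 2)); rewrite divr_gt0// => /(_ isT)/nbhs_ballP[r /= r0 H].
  near=> h => t zt tz; rewrite distrC; apply: H; rewrite /ball/= distrC ger0_norm ?subr_ge0//.
  have : 3 * h < r by rewrite mulrC -ltr_pdivlMr//; near: h; apply: nbhs_right_lt; rewrite divr_gt0.
  lra.
have [h [h0 hx hy hd]] : exists h, [/\ 0 < h,
    forall t, x <= t -> t <= x + 3 * h -> `|f' t - f' x| <= e / 2,
    forall t, y <= t -> t <= y + 3 * h -> `|f' t - f' y| <= e / 2 & y + 3 * h < d].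
  have xab : x \in `]a, b[ by rewrite in_itv/=; apply/andP; split; lra.
  have yab : y \in `]a, b[ by rewrite in_itv/=; apply/andP; split; lra.
  near (0:R)^'+ => h; exists h; split.
  - by near: h; exact: nbhs_right_gt.
  - by near: h; exact: small.
  - by near: h; exact: small.
  - suff : h < (d - y) / 3 by lra.
    by near: h; apply: nbhs_right_lt; rewrite divr_gt0// subr_gt0.
have h0' := ltW h0.
have ax : a < x by lra.
have ybd : y + 3 * h < b by lra.
have K0 : 0 < 6 * h ^+ 3 by rewrite mulr_gt0// exprn_gt0.
have := derive_on_plateau cf fv h0' ax xy ybd.
have := Rintegral_plateau_le h0' ac db cx xy hd iv.
have Bx := @bspline2_mean f' x h (e / 2) h0' (ltW ax) _ cf' hx.
have By := @bspline2_mean f' y h (e / 2) h0' _ (ltW ybd) cf' hy.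
have {}Bx := Bx ltac:(lra).
have {}By := By ltac:(lra).
have cB z : {within `[a, b], continuous (fun t => 3 * bspline 2 z h t)}.
  apply: continuous_subspaceT => t; apply: cvgM; first exact: cvg_cst.
  exact: continuous_bspline.
rewrite derive1_plateau.
under [X in _ -> X = _ -> _]eq_Rintegral do rewrite mulrBr mulrBr.
rewrite RintegralB//; last 2 first.
  exact/continuous_itv_integrable/within_continuousM.
  exact/continuous_itv_integrable/within_continuousM.
rewrite -/I -/f'; move: Bx By.
set Ax := \int[mu]_(_ in _) _; set Ay := \int[mu]_(_ in _) _.
set V := \int[mu]_(_ in _) _; set K := 6 * h ^+ 3 in K0 *.
move=> Bx By VI AV.
rewrite -(ler_pM2l K0) -[X in X * `|_|]gtr0_norm// -normrM.
have -> : K * (f' x - f' y) = (Ay - f' y * K) - (Ax - f' x * K) - V.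
  by rewrite -[V]opprK -AV; ring.
have N1 := ler_normB ((Ay - f' y * K) - (Ax - f' x * K)) V.
have N2 := ler_normB (Ay - f' y * K) (Ax - f' x * K).
lra.
Unshelve. all: by end_near. Qed.

End MeanInequality.

(** * A uniqueness principle for u'' = q u *)

Section Uniqueness.
Context {R : realType}.
Notation mu := (@lebesgue_measure R).
Variables (a b : R).
Hypothesis ab : a < b.
Implicit Types (f g v : R -> R) (x y h : R).

(** The interior estimate passes to the closed interval [c, d] by continuity of f':
    x and y are approximated by moving them slightly towards the midpoint. *)
Lemma C1_weak_le f v c d x y : C1_on a b f ->
  weak_second_derivative a b f v -> mu.-integrable `]a, b[ (EFin \o v) ->
  a <= c -> c < d -> d <= b -> x \in `[c, d] -> y \in `[c, d] ->
  `|derive_on a b f x - derive_on a b f y| <= \int[mu]_(t in `]c, d[) `|v t|.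
Proof.
move=> cf fv iv ac cd db; rewrite !in_itv/= => /andP[cx xd] /andP[cy yd].
apply/ler_addgt0Pr => e e0; set f' := derive_on a b f.
have approx z : c <= z -> z <= d ->
    exists z', [/\ c < z', z' < d & `|f' z - f' z'| <= e / 2].
  move=> cz zd.
  have zab : z \in `[a, b]%classic by rewrite inE/= in_itv/=; apply/andP; split; lra.
  have e2 : 0 < e / 2 by rewrite divr_gt0.
  have /subspace_continuousP/(_ z) := cf.2.
  rewrite inE in zab => /(_ zab) /cvgrPdist_le/(_ _ e2) H.
  have {H} /nbhs_ballP[r /= r0 H] : \forall t \near z,
    `[a, b]%classic t -> `|f' z - f' t| <= e / 2 by exact: H.
  pose m := (c + d) / 2; pose l := Num.min 1 (r / (2 * (d - c))).
  have l0 : 0 < l by rewrite lt_min ltr01 divr_gt0// mulr_gt0// subr_gt0.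
  have l1 : l <= 1 by rewrite ge_min lexx.
  have lr : l * (d - c) <= r / 2.
    rewrite -ler_pdivlMr ?subr_gt0// -mulrA -invfM ge_min.
    by rewrite lexx orbT.
  have cm : c < m by rewrite /m; lra.
  have md : m < d by rewrite /m; lra.
  have z'c : c < z + l * (m - z) by nra.
  have z'd : z + l * (m - z) < d by nra.
  exists (z + l * (m - z)); split => //.
  apply: H; last by rewrite /= in_itv/=; apply/andP; split; lra.
  rewrite /ball/= opprD addrA subrr sub0r normrN normrM gtr0_norm//.
  have : `|m - z| <= d - c by rewrite ler_norml; apply/andP; split; lra.
  have := normr_ge0 (m - z); nra.
have [x' [cx' xd' hx]] := approx x cx xd.
have [y' [cy' yd' hy]] := approx y cy yd.
have key : `|f' x' - f' y'| <= \int[mu]_(t in `]c, d[) `|v t|.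
  have [xy|/ltW yx] := leP x' y'; first exact: C1_weak_le_interior.
  by rewrite distrC; apply: C1_weak_le_interior.
have -> : f' x - f' y = (f' x - f' x') + (f' x' - f' y') - (f' y - f' y') by ring.
have N1 := ler_normB ((f' x - f' x') + (f' x' - f' y')) (f' y - f' y').
have N2 := ler_normD (f' x - f' x') (f' x' - f' y').
lra.
Qed.

(* f0 and f1 stand for the real and imaginary parts of a complex solution u,
   v0 and v1 for those of u'', and k for a bound of |q|; the bounds
   on v0 and v1 are those that u'' = q u gives. *)
Variables (f0 f1 v0 v1 k : R -> R).
Hypotheses (cf0 : C1_on a b f0) (cf1 : C1_on a b f1).
Hypotheses (fv0 : weak_second_derivative a b f0 v0)
           (fv1 : weak_second_derivative a b f1 v1).
Hypotheses (iv0 : mu.-integrable `]a, b[ (EFin \o v0))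
           (iv1 : mu.-integrable `]a, b[ (EFin \o v1))
           (ik : mu.-integrable `]a, b[ (EFin \o k)).
Hypothesis k0 : forall t, 0 <= k t.
Let N t := `|f0 t| + `|f1 t|.
Hypothesis vk0 : {ae mu, forall t, t \in `]a, b[ -> `|v0 t| <= k t * N t}.
Hypothesis vk1 : {ae mu, forall t, t \in `]a, b[ -> `|v1 t| <= k t * N t}.

Lemma le_Rintegral_bound v c d M : a <= c -> d <= b ->
  mu.-integrable `]a, b[ (EFin \o v) ->
  {ae mu, forall t, t \in `]a, b[ -> `|v t| <= k t * N t} ->
  0 <= M -> (forall t, t \in `[c, d] -> N t <= M) ->
  \int[mu]_(t in `]c, d[) `|v t| <= M * \int[mu]_(t in `]a, b[) k t.
Proof.
move=> ac db iv vk M0 NM.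
have cdab : `]c, d[%classic `<=` `]a, b[%classic by apply: subset_itv; rewrite bnd_simp.
rewrite -RintegralZl//.
have iMk : mu.-integrable `]a, b[ (EFin \o (fun t => M * k t)).
  by have := integrableZl _ M ik; apply.
have iv' : mu.-integrable `]c, d[ (EFin \o (fun t => `|v t|)).
  by apply: integrable_norm; exact: integrableS iv.
rewrite /Rintegral; apply: fine_le.
- exact: (integrable_fin_num _ iv').
- exact: (integrable_fin_num _ iMk).
apply: (@le_trans _ _ (\int[mu]_(t in `]c, d[) (M * k t)%:E)%E).
  apply: ae_ge0_le_integral => //.
  - exact: measurable_int iv'.
  - by move=> t _; rewrite lee_fin mulr_ge0.
  - by apply: measurable_int; exact: integrableS iMk.
  - move: vk; apply: filterS; first exact: (ae_filter_ringOfSetsType mu).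
    move=> t + /= tcd => /(_ (cdab _ tcd)) vt.
    rewrite lee_fin (le_trans vt)// mulrC ler_wpM2r// NM//.
    exact: subset_itv_oo_cc.
apply: ge0_subset_integral => //.
  exact: measurable_int iMk.
by move=> t _; rewrite lee_fin mulr_ge0.
Qed.

Definition vanishing_data s :=
  [/\ f0 s = 0, f1 s = 0, derive_on a b f0 s = 0 & derive_on a b f1 s = 0].

(** Contraction: if M is the maximum of |f0| + |f1| on [c, d] and I the integral of
    k over (a, b), then |fi'| <= M I on [c, d], hence |fi| <= (d - c) M I by the
    mean value theorem, and M <= 2 (d - c) I M forces M = 0.  Since I is the
    integral over all of (a, b), the admissible length d - c does not depend on
    the position of [c, d]. *)
Lemma vanishing_step c d s x : a <= c -> c < d -> d <= b ->
  2 * (d - c) * \int[mu]_(t in `]a, b[) k t < 1 ->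
  s \in `[c, d] -> x \in `[c, d] -> vanishing_data s -> vanishing_data x.
Proof.
move=> ac cd db small scd xcd [f0s f1s df0s df1s].
set I := \int[mu]_(_ in _) _ in small.
have I0 : 0 <= I by apply: Rintegral_ge0.
have cN : {within `[c, d], continuous N}.
  have sub : `[c, d]%classic `<=` `[a, b]%classic by apply: subset_itv; rewrite bnd_simp.
  have c0 := continuous_subspaceW sub (C1_on_continuous cf0).
  have c1 := continuous_subspaceW sub (C1_on_continuous cf1).
  by move=> t; apply: cvgD; apply: (@cvg_norm _ R^o); [exact: c0|exact: c1].
have [m mcd Nm] := @EVT_max R N c d (ltW cd) cN.
have N0 t : 0 <= N t by rewrite addr_ge0.
have dbound f v : C1_on a b f -> weak_second_derivative a b f v ->
    mu.-integrable `]a, b[ (EFin \o v) ->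
    {ae mu, forall t, t \in `]a, b[ -> `|v t| <= k t * N t} ->
    derive_on a b f s = 0 ->
    forall t, t \in `[c, d] -> `|derive_on a b f t| <= N m * I.
  move=> cf fv iv vk dfs t tcd.
  rewrite -[derive_on a b f t]subr0 -dfs.
  apply: le_trans (C1_weak_le cf fv iv ac cd db tcd scd) _.
  exact: le_Rintegral_bound.
have fbound f v : C1_on a b f -> weak_second_derivative a b f v ->
    mu.-integrable `]a, b[ (EFin \o v) ->
    {ae mu, forall t, t \in `]a, b[ -> `|v t| <= k t * N t} ->
    derive_on a b f s = 0 -> f s = 0 ->
    forall t, t \in `[c, d] -> `|f t| <= (d - c) * (N m * I).
  move=> cf fv iv vk dfs fs t tcd.
  have NI : 0 <= N m * I by rewrite mulr_ge0.
  have db' := dbound f v cf fv iv vk dfs.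
  move: (tcd) (scd); rewrite !in_itv/= => /andP[ct td] /andP[cs sd].
  have [st|/ltW ts] := leP s t.
    have [z zst] := C1_on_MVT cf (le_trans ac cs) st (le_trans td db).
    rewrite fs subr0 => ->; rewrite normrM mulrC ler_pM//.
      by rewrite ger0_norm; lra.
    apply: db'; move: zst; rewrite !in_itv/= => /andP[sz zt]; apply/andP; split; lra.
  have [z zst] := C1_on_MVT cf (le_trans ac ct) ts (le_trans sd db).
  rewrite fs sub0r -normrN => ->; rewrite normrM mulrC ler_pM//.
    by rewrite ger0_norm; lra.
  apply: db'; move: zst; rewrite !in_itv/= => /andP[sz zt]; apply/andP; split; lra.
have Nm0 : N m = 0.
  have B0 := fbound f0 v0 cf0 fv0 iv0 vk0 df0s f0s m mcd.
  have B1 := fbound f1 v1 cf1 fv1 iv1 vk1 df1s f1s m mcd.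
  have : N m <= 2 * (d - c) * I * N m.
    by rewrite {1}/N; lra.
  have := N0 m; nra.
have dx0 := dbound f0 v0 cf0 fv0 iv0 vk0 df0s x xcd.
have dx1 := dbound f1 v1 cf1 fv1 iv1 vk1 df1s x xcd.
have := Nm x xcd; rewrite Nm0 /N => Nx.
rewrite Nm0 mul0r normr_le0 in dx0; rewrite Nm0 mul0r normr_le0 in dx1.
have n0 := normr_ge0 (f0 x); have n1 := normr_ge0 (f1 x).
by split; apply/eqP => //; rewrite -normr_le0; lra.
Qed.

(** Since the admissible step length r is uniform, every point of [a, b] is
    reached from s in finitely many steps. *)
Lemma vanishing_everywhere s x : s \in `[a, b] -> x \in `[a, b] ->
  vanishing_data s -> vanishing_data x.
Proof.
move=> sab xab hs.
set I := \int[mu]_(t in `]a, b[) k t.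
have I0 : 0 <= I by apply: Rintegral_ge0.
pose r := (2 * (I + 1))^-1.
have r0 : 0 < r by rewrite invr_gt0; lra.
have rI : 2 * r * I < 1.
  have : r * (2 * (I + 1)) = 1 by rewrite mulVf//; lra.
  nra.
have steps n : forall y, y \in `[a, b] -> `|y - s| <= n%:R * r -> vanishing_data y.
  elim: n => [|n IH] y yab.
    by rewrite mul0r normr_le0 subr_eq0 => /eqP ->.
  move=> yn.
  (* the point at distance at most r from y that n steps suffice to reach *)
  pose z := s + n%:R / n.+1%:R * (y - s).
  have n1 : 0 < n.+1%:R :> R by [].
  have l0 : 0 <= n%:R / n.+1%:R :> R by rewrite divr_ge0.
  have l1 : n%:R / n.+1%:R <= 1 :> R by rewrite ler_pdivrMr// mul1r ler_nat.
  have zab : z \in `[a, b].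
    move: yab sab l0 l1; rewrite !in_itv/= /z; set l := n%:R / _.
    move=> /andP[ay yb] /andP[as' sb] l0 l1.
    have P1 : 0 <= l * (y - a) by rewrite mulr_ge0 ?subr_ge0.
    have P2 : 0 <= l * (b - y) by rewrite mulr_ge0 ?subr_ge0.
    have P3 : 0 <= (1 - l) * (s - a) by rewrite mulr_ge0 ?subr_ge0.
    have P4 : 0 <= (1 - l) * (b - s) by rewrite mulr_ge0 ?subr_ge0.
    by apply/andP; split; lra.
  have zs : `|z - s| <= n%:R * r.
    rewrite /z addrAC subrr add0r normrM ger0_norm// ?divr_ge0//.
    by rewrite -mulrA ler_wpM2l// ler_pdivrMl.
  have yz : `|y - z| <= r.
    have -> : y - z = (y - s) / n.+1%:R by rewrite /z; field; rewrite gt_eqF.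
    by rewrite normrM normfV [`|n.+1%:R|]gtr0_norm// ler_pdivrMr// mulrC.
  have hz := IH z zab zs.
  move: (yab) (zab); rewrite !in_itv/= => /andP[ay yb] /andP[az zb].
  have [yz'|zy|yz'] := ltgtP y z; last by rewrite yz'.
  - apply: (@vanishing_step y z z) => //; rewrite -/I; try by rewrite in_itv/= lexx ltW.
    move: yz; rewrite distrC gtr0_norm ?subr_gt0// => yz; nra.
  - apply: (@vanishing_step z y z) => //; rewrite -/I; try by rewrite in_itv/= lexx ltW.
    move: yz; rewrite gtr0_norm ?subr_gt0// => yz; nra.
apply: (steps (Num.bound (`|x - s| / r))) => //.
rewrite -ler_pdivrMr// ltW// archi_boundP// divr_ge0// ltW//.
Qed.

End Uniqueness.

(** * Complex-valued solutions *)

Section ComplexLayer.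
Context {R : realType}.
Notation mu := (@lebesgue_measure R).
Local Notation Re := (@complex.Re R).
Local Notation Im := (@complex.Im R).

Lemma Re_lin (c z w : R[i]) :
  Re (c * z + w) = Re c * Re z + (- Im c * Im z + Re w).
Proof. by case: c z w => [c0 c1] [z0 z1] [w0 w1] /=; ring. Qed.

Lemma Im_lin (c z w : R[i]) :
  Im (c * z + w) = Re c * Im z + (Im c * Re z + Im w).
Proof. by case: c z w => [c0 c1] [z0 z1] [w0 w1] /=; ring. Qed.

Lemma Re_mulr (z : R[i]) (r : R) : Re (z * r%:C) = Re z * r.
Proof. by case: z => z0 z1 /=; ring. Qed.

Lemma Im_mulr (z : R[i]) (r : R) : Im (z * r%:C) = Im z * r.
Proof. by case: z => z0 z1 /=; ring. Qed.

Section Integrals.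
Variable D : set R.
Hypothesis mD : measurable (D : set (measurableTypeR R)).
Implicit Types f g : R -> R[i].

Lemma integrable_lin (r : R) (f g : R -> R) :
  mu.-integrable D (EFin \o f) -> mu.-integrable D (EFin \o g) ->
  mu.-integrable D (EFin \o (fun x => r * f x + g x)).
Proof.
move=> fi gi; have rf := integrableZl mD r fi.
by have := integrableD mD rf gi; apply.
Qed.

Lemma Rintegral_lin (r : R) (f g : R -> R) :
  mu.-integrable D (EFin \o f) -> mu.-integrable D (EFin \o g) ->
  \int[mu]_(x in D) (r * f x + g x) =
  r * \int[mu]_(x in D) f x + \int[mu]_(x in D) g x.
Proof.
move=> fi gi; rewrite RintegralD// ?RintegralZl//.
by have := integrableZl mD r fi; apply.
Qed.

Lemma cintegrable_lin (c : R[i]) f g : cintegrable D f -> cintegrable D g ->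
  cintegrable D (fun x => c * f x + g x).
Proof.
move=> [f0 f1] [g0 g1]; split.
- under eq_fun do rewrite Re_lin.
  by do 2 (apply: integrable_lin => //).
- under eq_fun do rewrite Im_lin.
  by do 2 (apply: integrable_lin => //).
Qed.

Lemma cintegral_lin (c : R[i]) f g : cintegrable D f -> cintegrable D g ->
  cintegral D (fun x => c * f x + g x) = c * cintegral D f + cintegral D g.
Proof.
move=> [f0 f1] [g0 g1]; apply/eqP; rewrite eq_complex; apply/andP; split; apply/eqP.
- rewrite Re_lin /=; under eq_Rintegral do rewrite Re_lin.
  by rewrite !Rintegral_lin//; exact: integrable_lin.
- rewrite Im_lin /=; under eq_Rintegral do rewrite Im_lin.
  by rewrite !Rintegral_lin//; exact: integrable_lin.
Qed.

Lemma cintegrableM f (g : R -> R) : cintegrable D f -> continuous g ->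
  (exists K, forall t, D t -> `|g t| <= K) ->
  cintegrable D (fun x => f x * (g x)%:C).
Proof.
move=> [f0 f1] cg gK; split.
- under eq_fun do rewrite Re_mulr.
  exact: integrableM_continuous.
- under eq_fun do rewrite Im_mulr.
  exact: integrableM_continuous.
Qed.

End Integrals.

Variables (a b : R).
Hypothesis ab : a < b.
Implicit Types (u v w f : R -> R[i]).

(** Bounded factors keep integrability; this gives the bounds for test functions
    and their derivatives. *)
Lemma continuous_bounded_oo (g : R -> R) : continuous g ->
  exists K, forall t, (`]a, b[%classic : set R) t -> `|g t| <= K.
Proof.
move=> cg.
have [||m _ gm] := @EVT_max R (fun t => `|g t|) a b; first exact: ltW.
  by apply: continuous_subspaceT => t; apply: (@cvg_norm _ R^o); exact: cg.
by exists `|g m| => t tab; apply: gm; exact: subset_itv_oo_cc.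
Qed.

Lemma weak_derivative_lin (c : R[i]) u1 u2 v1 v2 :
  weak_derivative a b u1 v1 -> weak_derivative a b u2 v2 ->
  weak_derivative a b (fun x => c * u1 x + u2 x) (fun x => c * v1 x + v2 x).
Proof.
move=> [iu1 iv1 e1] [iu2 iv2 e2].
have mI : measurable (`]a, b[ : set (measurableTypeR R)) by [].
split; [exact: cintegrable_lin..|].
move=> eta teta; have [deta ceta _] := teta.
have ceta0 : continuous eta by move=> t; exact/differentiable_continuous/derivable1_diffP.
have b0 := continuous_bounded_oo ceta0; have b1 := continuous_bounded_oo ceta.
have splitM (z w : R -> R[i]) (g : R -> R) : (fun x => (c * z x + w x) * (g x)%:C) =
    (fun x => c * (z x * (g x)%:C) + w x * (g x)%:C).
  by apply/funext => x; rewrite mulrDl mulrA.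
rewrite !splitM !cintegral_lin; try exact: mI; try exact: cintegrableM.
by rewrite e1// e2//; ring.
Qed.

Lemma cC1_on_lin (c : R[i]) u1 u2 : cC1_on a b u1 -> cC1_on a b u2 ->
  cC1_on a b (fun x => c * u1 x + u2 x).
Proof.
move=> [r1 i1] [r2 i2]; split.
- under eq_fun do rewrite Re_lin.
  by do 2 (apply: C1_on_lin => //).
- under eq_fun do rewrite Im_lin.
  by do 2 (apply: C1_on_lin => //).
Qed.

Lemma cderive_on_lin (c : R[i]) u1 u2 x : cC1_on a b u1 -> cC1_on a b u2 ->
  x \in `[a, b] ->
  cderive_on a b (fun x => c * u1 x + u2 x) x =
  c * cderive_on a b u1 x + cderive_on a b u2 x.
Proof.
move=> [r1 i1] [r2 i2] xab.
apply/eqP; rewrite eq_complex; apply/andP; split; apply/eqP.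
- rewrite Re_lin /=; under eq_fun do rewrite Re_lin.
  by rewrite !derive_on_lin//; exact: C1_on_lin.
- rewrite Im_lin /=; under eq_fun do rewrite Im_lin.
  by rewrite !derive_on_lin//; exact: C1_on_lin.
Qed.

Lemma L_equation_lin q (c : R[i]) u1 u2 f1 f2 :
  L_equation a b q u1 f1 -> L_equation a b q u2 f2 ->
  L_equation a b q (fun x => c * u1 x + u2 x) (fun x => c * f1 x + f2 x).
Proof.
move=> [v1 [[C1 [w1 [uw1 wv1]]] e1]] [v2 [[C2 [w2 [uw2 wv2]]] e2]].
exists (fun x => c * v1 x + v2 x); split.
  split; first exact: cC1_on_lin.
  by exists (fun x => c * w1 x + w2 x); split; exact: weak_derivative_lin.
move: e1 e2; apply: filterS2; first exact: (ae_filter_ringOfSetsType mu).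
move=> x + + xab => /(_ xab) <- /(_ xab) <-.
by ring.
Qed.

Lemma L_equation_eq q u f g : {in `]a, b[, f =1 g} ->
  L_equation a b q u f -> L_equation a b q u g.
Proof.
move=> fg [v [uv e]]; exists v; split=> //.
move: e; apply: filterS; first exact: (ae_filter_ringOfSetsType mu).
by move=> x + xab => /(_ xab) ->; rewrite fg.
Qed.

Lemma L_equation_C1 q u f : L_equation a b q u f -> cC1_on a b u.
Proof. by move=> [v [[]]]. Qed.

Lemma weak_second_derivative_ReIm u w v :
  weak_derivative a b u w -> weak_derivative a b w v ->
  weak_second_derivative a b (Re \o u) (Re \o v) /\
  weak_second_derivative a b (Im \o u) (Im \o v).
Proof.
move=> [_ _ uw] [_ _ wv].
have key eta : test_function a b eta -> test_function a b eta^`()%classic ->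
    cintegral `]a, b[ (fun x => u x * (eta^`()^`()%classic x)%:C) =
    cintegral `]a, b[ (fun x => v x * (eta x)%:C).
  by move=> t0 t1; rewrite uw// wv// opprK.
split=> eta t0 t1; have := key eta t0 t1.
- move=> /(congr1 Re)/=.
  by under eq_Rintegral do rewrite Re_mulr; under [RHS]eq_Rintegral do rewrite Re_mulr.
- move=> /(congr1 Im)/=.
  by under eq_Rintegral do rewrite Im_mulr; under [RHS]eq_Rintegral do rewrite Im_mulr.
Qed.

Lemma normr_ReM_le (z w : R[i]) :
  `|Re (z * w)| <= (`|Re z| + `|Im z|) * (`|Re w| + `|Im w|).
Proof.
case: z w => [z0 z1] [w0 w1] /=.
rewrite (le_trans (ler_normB _ _))// !normrM.
have := mulr_ge0 (normr_ge0 z0) (normr_ge0 w1).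
have := mulr_ge0 (normr_ge0 z1) (normr_ge0 w0).
lra.
Qed.

Lemma normr_ImM_le (z w : R[i]) :
  `|Im (z * w)| <= (`|Re z| + `|Im z|) * (`|Re w| + `|Im w|).
Proof.
case: z w => [z0 z1] [w0 w1] /=.
rewrite (le_trans (ler_normD _ _))// !normrM.
have := mulr_ge0 (normr_ge0 z0) (normr_ge0 w0).
have := mulr_ge0 (normr_ge0 z1) (normr_ge0 w1).
lra.
Qed.

(** Multiplication by q couples the real and imaginary parts of u, so they are
    treated as a pair, with |Re q| + |Im q| in the role of the bound. *)
Lemma L_equation_unique0 q u s x : cintegrable `]a, b[ q ->
  L_equation a b q u (fun=> 0) -> s \in `[a, b] -> x \in `[a, b] ->
  u s = 0 -> cderive_on a b u s = 0 -> u x = 0.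
Proof.
move=> [iq0 iq1] [v [[[c0 c1] [w [uw wv]]] e]] sab xab us dus.
have [W0 W1] := weak_second_derivative_ReIm uw wv.
have [_ [iv0 iv1] _] := wv.
have mI : measurable (`]a, b[ : set (measurableTypeR R)) by [].
have ik : mu.-integrable `]a, b[ (EFin \o (fun t => `|Re (q t)| + `|Im (q t)|)).
  have := integrableD mI (integrable_norm iq0) (integrable_norm iq1); exact.
have k0 t : 0 <= `|Re (q t)| + `|Im (q t)| by rewrite addr_ge0.
have vq : {ae mu, forall t, t \in `]a, b[ -> v t = q t * u t}.
  move: e; apply: filterS; first exact: (ae_filter_ringOfSetsType mu).
  by move=> t + tab => /(_ tab)/eqP; rewrite subr_eq0 => /eqP.
have vk0 : {ae mu, forall t, t \in `]a, b[ -> `|Re (v t)| <=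
    (`|Re (q t)| + `|Im (q t)|) * (`|Re (u t)| + `|Im (u t)|)}.
  move: vq; apply: filterS; first exact: (ae_filter_ringOfSetsType mu).
  by move=> t + tab => /(_ tab) ->; exact: normr_ReM_le.
have vk1 : {ae mu, forall t, t \in `]a, b[ -> `|Im (v t)| <=
    (`|Re (q t)| + `|Im (q t)|) * (`|Re (u t)| + `|Im (u t)|)}.
  move: vq; apply: filterS; first exact: (ae_filter_ringOfSetsType mu).
  by move=> t + tab => /(_ tab) ->; exact: normr_ImM_le.
have hs : vanishing_data a b (Re \o u) (Im \o u) s.
  have d0 := congr1 Re dus; have d1 := congr1 Im dus.
  by split => //=; rewrite us.
have [x0 x1 _ _] := vanishing_everywhere ab c0 c1 W0 W1 iv0 iv1 ik k0 vk0 vk1 sab xab hs.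
by apply/eqP; rewrite eq_complex; apply/andP; split; apply/eqP.
Qed.

End ComplexLayer.

(** * Expansion of one standard L-base in another *)

Section LBases.
Context {R : realType}.
Variables (a b : R) (q : R -> R[i]).
Hypotheses (ab : a < b) (iq : cintegrable `]a, b[ q).

(** The difference u0 - c u1 - d u2 solves the homogeneous equation with zero
    Cauchy data at s. *)
Lemma L_equation_unique (u0 u1 u2 f0 f1 f2 : R -> R[i]) (c d : R[i]) (s x : R) :
  L_equation a b q u0 f0 -> L_equation a b q u1 f1 -> L_equation a b q u2 f2 ->
  s \in `[a, b] -> x \in `[a, b] ->
  (forall y, y \in `[a, b] -> f0 y = c * f1 y + d * f2 y) ->
  u0 s = c * u1 s + d * u2 s ->
  cderive_on a b u0 s = c * cderive_on a b u1 s + d * cderive_on a b u2 s ->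
  u0 x = c * u1 x + d * u2 x.
Proof.
move=> e0 e1 e2 sab xab ef es eds.
have e20 := L_equation_lin ab (- d) e2 e0.
have e120 := L_equation_lin ab (- c) e1 e20.
have [C0 C1 C2] := And3 (L_equation_C1 e0) (L_equation_C1 e1) (L_equation_C1 e2).
have := @L_equation_unique0 R a b ab q _ s x iq (L_equation_eq _ e120) sab xab.
rewrite cderive_on_lin//; last exact: cC1_on_lin.
rewrite cderive_on_lin// es eds => H.
apply/eqP; rewrite -subr_eq0; apply/eqP.
rewrite -[RHS]H; [by ring| |by ring|by ring].
by move=> y /subset_itv_oo_cc yab; rewrite ef//; ring.
Qed.

Lemma cramer (D p p' a0 a0' a1 a1' : R[i]) : D = a0 * a1' - a0' * a1 -> D != 0 ->
  p = (p * a1' - p' * a1) / D * a0 + - ((p * a0' - p' * a0) / D) * a1 /\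
  p' = (p * a1' - p' * a1) / D * a0' + - ((p * a0' - p' * a0) / D) * a1'.
Proof. by move=> -> D0; split; field. Qed.

Variables (phi psi : nat -> R -> R[i]) (t : R).
Hypotheses (hphi : standard_L_base a b q phi) (hpsi : standard_L_base a b q psi).
Hypotheses (h0 : 0 \in `[a, b]) (ht : t \in `[a, b]).
Let W u v := wronskian a b u v t.
Hypothesis hW : W (psi 0%N) (psi 1%N) != 0.

Let D := W (psi 0%N) (psi 1%N).
Let c00 := W (phi 0%N) (psi 1%N) / D.
Let c01 := - (W (phi 0%N) (psi 0%N) / D).
Let c10 := W (phi 1%N) (psi 1%N) / D.
Let c11 := - (W (phi 1%N) (psi 0%N) / D).

(** For j = 0 the Cauchy data at t are matched by Cramer's rule.  For the
    successor of j all Cauchy data at 0 vanish, and the right-hand sides agree by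
    induction: the factors k (k - 1) of phi_k'' combine with 1/(2j+1) and 2j+1
    into the coefficients of the next pair. *)
Lemma standard_L_base_comb j :
  (forall x, x \in `[a, b] -> phi j.*2 x =
     c00 * psi j.*2 x + c01 / j.*2.+1%:R * psi j.*2.+1 x) /\
  (forall x, x \in `[a, b] -> phi j.*2.+1 x =
     j.*2.+1%:R * c10 * psi j.*2 x + c11 * psi j.*2.+1 x).
Proof.
have [[P0 P1 P] Pz] := hphi; have [[S0 S1 S] Sz] := hpsi.
have nz n : n.+1%:R != 0 :> R[i] by rewrite pnatr_eq0.
elim: j => [|j [IH0 IH1]].
  rewrite double0 mul1r divr1; split=> x xab.
  - have [E E'] := @cramer D (phi 0%N t) (cderive_on a b (phi 0%N) t) _ _ _ _ erefl hW.
    by apply: (L_equation_unique P0 S0 S1 ht xab) => // y _; rewrite !mulr0 addr0.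
  - have [E E'] := @cramer D (phi 1%N t) (cderive_on a b (phi 1%N) t) _ _ _ _ erefl hW.
    by apply: (L_equation_unique P1 S0 S1 ht xab) => // y _; rewrite !mulr0 addr0.
have ge2 n : (2 <= n.+2)%N by [].
rewrite doubleS; split=> x xab.
- apply: (L_equation_unique (P _ (ge2 _)) (S _ (ge2 _)) (S _ (ge2 _)) h0 xab).
  + move=> y yab; rewrite !subn2 !subn1/= IH0// !natrM; field.
    by rewrite -natrD nat1r; apply/andP; split; exact: nz.
  + by rewrite !(Pz _ (ge2 _)).1 !(Sz _ (ge2 _)).1 !mulr0 addr0.
  + by rewrite !(Pz _ (ge2 _)).2 !(Sz _ (ge2 _)).2 !mulr0 addr0.
- apply: (L_equation_unique (P _ (ge2 _)) (S _ (ge2 _)) (S _ (ge2 _)) h0 xab).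
  + by move=> y yab; rewrite !subn2 !subn1/= IH1// !natrM; ring.
  + by rewrite !(Pz _ (ge2 _)).1 !(Sz _ (ge2 _)).1 !mulr0 addr0.
  + by rewrite !(Pz _ (ge2 _)).2 !(Sz _ (ge2 _)).2 !mulr0 addr0.
Qed.

End LBases.

(** * Parity and primitives of polynomials *)

Section Polynomials.
Context {R : realType}.
Implicit Types (p r : {poly R[i]}) (c : R[i]).

Lemma poly_even_part_lin c p r :
  poly_even_part (c *: p + r) = c *: poly_even_part p + poly_even_part r.
Proof. by rewrite /poly_even_part comp_polyD comp_polyZ -!mul_polyC; ring. Qed.

Lemma poly_odd_part_lin c p r :
  poly_odd_part (c *: p + r) = c *: poly_odd_part p + poly_odd_part r.
Proof. by rewrite /poly_odd_part comp_polyD comp_polyZ -!mul_polyC; ring. Qed.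

Lemma coef_poly_primitive p i :
  (poly_primitive p)`_i = p`_i.-1 / i%:R *+ (i != 0%N).
Proof.
rewrite coef_poly ltnS; case: leqP => // pi.
by rewrite [p`__]nth_default ?mul0r ?mul0rn// -ltnS (ltn_predK pi).
Qed.

Lemma poly_primitive_lin c p r :
  poly_primitive (c *: p + r) = c *: poly_primitive p + poly_primitive r.
Proof.
apply/polyP => i; rewrite coefD coefZ !coef_poly_primitive coefD coefZ.
by case: eqP => _; rewrite ?mulr0n ?mulr1n; ring.
Qed.

Lemma poly_primitiveXn n : poly_primitive ('X^n : {poly R[i]}) = n.+1%:R^-1 *: 'X^(n.+1).
Proof.
apply/polyP => -[|i]; rewrite coef_poly_primitive coefZ !coefXn ?mulr0//=.
by rewrite mulr1n eqSS; case: eqP => [->|_]; rewrite ?mulr1 ?mul1r ?mulr0 ?mul0r.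
Qed.

Lemma comp_XnN n : ('X^n : {poly R[i]}) \Po - 'X = (-1) ^+ n *: 'X^n.
Proof. by rewrite comp_Xn_poly -scaleN1r exprZn. Qed.

Lemma scale_halfD p : 2^-1 *: (p + p) = p.
Proof. by rewrite scalerDr -scalerDl -[2^-1]mul1r -splitr scale1r. Qed.

Lemma poly_even_partXn n : 
  poly_even_part 'X^n = (if odd n then 0 else 'X^n) :> {poly R[i]}.
Proof.
rewrite /poly_even_part comp_XnN -signr_odd; case: (odd n) => /=.
  by rewrite expr1 scaleN1r subrr scaler0.
by rewrite expr0 scale1r scale_halfD.
Qed.

Lemma poly_odd_partXn n : 
  poly_odd_part 'X^n = (if odd n then 'X^n else 0) :> {poly R[i]}.
Proof.
rewrite /poly_odd_part comp_XnN -signr_odd; case: (odd n) => /=.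
  by rewrite expr1 scaleN1r opprK scale_halfD.
by rewrite expr0 scale1r subrr scaler0.
Qed.

Lemma poly_linear_ext (F G : {poly R[i]} -> R[i]) :
  (forall c p r, F (c *: p + r) = c * F p + F r) ->
  (forall c p r, G (c *: p + r) = c * G p + G r) ->
  (forall k, F 'X^k = G 'X^k) -> F =1 G.
Proof.
have zero (H : {poly R[i]} -> R[i]) :
    (forall c p r, H (c *: p + r) = c * H p + H r) -> H 0 = 0.
  move=> lH; have := lH 1 0 0; rewrite scaler0 addr0 mul1r => /eqP.
  by rewrite -subr_eq subrr eq_sym => /eqP.
move=> lF lG FG p; rewrite -[p]coefK poly_def.
elim: (size p) => [|n IH]; first by rewrite big_ord0 !zero.
by rewrite big_ord_recr/= addrC lF lG FG IH.
Qed.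

End Polynomials.

Theorem proposition18 (R : realType) (a b : R) (hab : a < b)
    (h0 : 0 \in `[a, b])
    (q : R -> R[i]) (hq : cintegrable `]a, b[ q)
    (phi psi : nat -> R -> R[i])
    (hphi : standard_L_base a b q phi) (hpsi : standard_L_base a b q psi)
    (t : R) (ht : t \in `[a, b])
    (hW : wronskian a b (psi 0%N) (psi 1%N) t != 0)
    (Tphi Tpsi : {poly R[i]} -> R -> R[i])
    (hTphi : standard_transmutation a b q Tphi)
    (hTpsi : standard_transmutation a b q Tpsi)
    (hTphiX : forall k x, x \in `[a, b] -> Tphi 'X^k x = phi k x)
    (hTpsiX : forall k x, x \in `[a, b] -> Tpsi 'X^k x = psi k x) :
  let W u v := wronskian a b u v t in
  forall (p : {poly R[i]}) (x : R), x \in `[a, b] ->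
    Tphi p x =
      W (phi 0%N) (psi 1%N) / W (psi 0%N) (psi 1%N)
        * Tpsi (poly_even_part p) x
      - W (phi 0%N) (psi 0%N) / W (psi 0%N) (psi 1%N)
        * Tpsi (poly_primitive (poly_even_part p)) x
      + W (phi 1%N) (psi 1%N) / W (psi 0%N) (psi 1%N)
        * Tpsi (poly_odd_part p)^`() x
      - W (phi 1%N) (psi 0%N) / W (psi 0%N) (psi 1%N)
        * Tpsi (poly_odd_part p) x.
Proof.
move=> W p x xab.
have lphi := hTphi.1.1; have lpsi := hTpsi.1.1.
have Z (T : {poly R[i]} -> R -> R[i]) : transmutation a b q T -> T 0 x = 0.
  move=> [lT _]; have := lT 1 0 0 x xab; rewrite scaler0 addr0 mul1r => /eqP.
  by rewrite -subr_eq subrr eq_sym => /eqP.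
move: p; apply: poly_linear_ext => [c p r|c p r|k]; first exact: lphi.
  rewrite poly_even_part_lin poly_odd_part_lin derivD derivZ poly_primitive_lin.
  by rewrite !lpsi//; ring.
have Tz : Tpsi 0 x = 0 by apply: Z hTpsi.1.
have scal c r : Tpsi (c *: r) x = c * Tpsi r x by rewrite -[c *: r]addr0 lpsi// Tz addr0.
have scaln n r : Tpsi (r *+ n) x = n%:R * Tpsi r x by rewrite -scaler_nat scal.
have [E O] := standard_L_base_comb hab hq hphi hpsi h0 ht hW k./2.
rewrite hTphiX// poly_even_partXn poly_odd_partXn.
have prim0 : poly_primitive 0 = 0 :> {poly R[i]}.
  by apply/polyP => i; rewrite coef_poly_primitive !coef0 mul0r mul0rn.
rewrite -(odd_double_half k) oddD odd_double addbF; case: (odd k) => /=.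
- rewrite add1n O// prim0 derivXn /= scaln Tz !hTpsiX//; rewrite /W; ring.
- rewrite add0n E// deriv0 poly_primitiveXn scal Tz !hTpsiX//; rewrite /W; ring.
Qed.
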